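(* There are positive universal numerical constants $c_1$ and $c_2$ such that the following holds. Let $\Phi$ be a $\mathbf{\Phi}$-function. Assume that, for every $N\ge1$, there is a number $K=K(N,\Phi)>0$ such that $$\sup_{0<t\le\sqrt N}\frac{\Phi(K^{-1}t)}{t^2}<1.$$ Then for every compact $\Omega\subset\mathbb{R}^d$, every Borel probability measure $\mu$ on $\Omega$, every $N\ge1$ and every $N$-dimensional subspace $X_N\subset C(\Omega)$, there are $m\le c_1N$ and points $\mathbf{x}=\{x_1,\dots,x_m\}\subset\Omega$ (not necessarily distinct) for which $$\|f\|_\Phi\le c_2K(N,\Phi)\,\|f\|_{2,\mathbf{x}}\quad\forall f\in X_N.$$
   Context: ''Increasing'' is meant in the non-strict sense. A $\mathbf{\Phi}$-function is an increasing function $\Phi:[0,\infty)\to[0,\infty)$ with $\Phi(0)=0$, $\lim_{t\to0+}\Phi(t)=0$, $\lim_{t\to\infty}\Phi(t)=\infty$, such that $t\mapsto\Phi(t)t^{-1}$ is almost increasing on $(0,\infty)$, i.e. there is $a\ge1$ with $\Phi(s)s^{-1}\le a\,\Phi(t)t^{-1}$ for all $0<s<t$. $C(\Omega)$ is the space of continuous (real- or complex-valued) functions on $\Omega$. $\|f\|_\Phi=\|f\|_{L^\Phi(\mu)}:=\inf\{\lambda>0:\int_\Omega\Phi(|f|/\lambda)\,d\mu\le1\}$ and $\|f\|_{2,\mathbf{x}}:=\bigl(\frac1m\sum_{j=1}^m|f(x_j)|^2\bigr)^{1/2}$. *)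

(* Defs.v *)
From HB Require Import structures.
From mathcomp Require Import all_boot all_order all_algebra.
From mathcomp Require Import all_classical all_reals all_analysis.
From mathcomp Require Import complex.
Set Implicit Arguments.
Unset Strict Implicit.
Unset Printing Implicit Defensive.
Import Order.TTheory GRing.Theory Num.Theory.
Import numFieldNormedType.Exports.

Local Open Scope classical_set_scope.
Local Open Scope ring_scope.

Record Phi_function (R : realType) (Phi : R -> R) : Prop := PhiFunction {
  Phi_ge0 : forall t : R, 0 <= t -> 0 <= Phi t;
  Phi_incr : forall s t : R, 0 <= s -> s <= t -> Phi s <= Phi t;
  Phi_at0 : Phi 0 = 0;
  Phi_cvg0 : Phi t @[t --> 0^'+] --> 0;
  Phi_cvgy : Phi t @[t --> +oo] --> +oo;
  Phi_almost_incr : exists2 a : R, 1 <= a &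
    forall s t : R, 0 < s -> s < t -> Phi s * s^-1 <= a * (Phi t * t^-1)
}.

(* The two admissible scalar fields, each with its R-valued modulus (on R[i]
   the library norm takes its values in R[i]). *)
Inductive scalar_field (R : realType) :
    forall F : numFieldType, (F -> R) -> Prop :=
| real_scalars : scalar_field (fun x : R => `|x|)
| complex_scalars : scalar_field (fun z : R[i] => ComplexField.Normc.normc z).

(* Omega as a topological space (with the subspace topology). Measurable types
   are required to be pointed, hence the dependency on a point p of Omega; it
   plays no other role. *)
Definition pointed_sub (T : topologicalType) (Omega : set T) (p : Omega) :=
  set_type Omega.

HB.instance Definition _ (T : topologicalType) (Omega : set T) (p : Omega) :=
  Topological.copy (pointed_sub p) (set_type Omega).
HB.instance Definition _ (T : topologicalType) (Omega : set T) (p : Omega) :=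
  isPointed.Build (pointed_sub p) p.

Definition borel (T : ptopologicalType) := g_sigma_algebraType (@open T).

(* The library topology of a numFieldType F is attached to F^o. *)
Definition C_space (F : numFieldType) (T : topologicalType) : set (T -> F) :=
  [set f | continuous (f : T -> F^o)].

Definition subspace_of_dim (F : numFieldType) (T : Type) (N : nat)
    (X : set (T -> F)) : Prop :=
  exists b : 'I_N -> T -> F,
    (forall c : 'I_N -> F,
       (forall x, \sum_(i < N) c i * b i x = 0) -> forall i, c i = 0) /\
    X = [set f | exists c : 'I_N -> F,
                   f = fun x => \sum_(i < N) c i * b i x].

(* The infimum is taken in the extended reals, so it is +oo on the empty set. *)
Definition norm_Phi (R : realType) (F : Type) (modulus : F -> R)
    (Phi : R -> R) d (T : measurableType d) (mu : {measure set T -> \bar R})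
    (f : T -> F) : \bar R :=
  ereal_inf [set l%:E | l in [set l : R | (0 < l)%R /\
    (\int[mu]_x (Phi (modulus (f x) / l))%:E <= 1)%E]].

Definition norm_2x (R : realType) (F : Type) (modulus : F -> R) (T : Type)
    (m : nat) (x : 'I_m -> T) (f : T -> F) : R :=
  Num.sqrt (m%:R^-1 * \sum_(j < m) modulus (f (x j)) ^+ 2).

(* Main.v *)
Require Import Defs.
From mathcomp Require Import all_boot all_order all_algebra.
From mathcomp Require Import all_classical all_reals all_analysis.
From mathcomp Require Import perm complex measurable_realfun.
From mathcomp Require Import ring lra zify.
Set Implicit Arguments.
Unset Strict Implicit.
Unset Printing Implicit Defensive.
Import Order.TTheory GRing.Theory Num.Theory.
Import numFieldNormedType.Exports.
Local Open Scope classical_set_scope.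
Local Open Scope ring_scope.

(** Taking real and imaginary parts, the space [X_N] is described by a bounded
    map [v] from [Omega] to [R^n] with [n = 2 N]: the square of [|f|] is a sum
    of two squares of functions [x |-> dot c (v x)].  Write [G] for the second
    moment matrix of [v] under [mu], so that [dot c (G *m c)] is the integral
    of [dot c (v x) ^+ 2], and [gram v s] for the sum of the matrices
    [v y (v y)^T] over the points [y] of [s].  Discretization asks for few
    points [s] whose Gram matrix controls both the supremum and the [L_2(mu)]
    norm.

    Supremum: choose [2 n] points whose Gram matrix has a nearly maximal
    determinant (a D-optimal design).  Replacing one of the points by [x]
    cannot increase the determinant much; summing the resulting inequalities
    over the replaced point yields [dot (v x) (M^-1 *m v x) <= 1] for
    [M = gram v s] ([optimal_design]), and by Cauchy-Schwarz
    [dot c (v x) ^+ 2] is at most the sum of the [dot c (v y) ^+ 2].  This is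
    the bound of the supremum by [sqrt N] times an average, up to a constant.

    [L_2(mu)] norm: add [4 n] points with the lower barrier of Batson, Spielman
    and Srivastava.  One starts from [B = M + 3 n G] and at each step replaces
    [B] by [B - G + 2 v(x) v(x)^T], keeping [B] positive definite and the
    barrier [\tr (G B^-1)] at most 1/3.  An admissible [x] exists because the
    condition on [x], averaged with respect to [mu], is implied by the bound of
    the barrier ([barrier_step]).  Since only a lower bound is wanted, every
    step may use the same weight 2, which is why no weights appear in the
    conclusion.  After [4 n] steps the coefficient of [G] is [- n], hence
    [n G <= M + 2 gram v s'] ([barrier_gram]).

    Orlicz norm: with [lam = 4 ||f||_{2,x}] the two bounds say that
    [|f| <= sqrt N lam] and that the integral of [|f|^2] is at most [lam^2].
    The hypothesis on [K] turns the first one into the pointwise inequality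
    [Phi (|f| / (K lam)) <= (|f| / lam)^2], which integrates to at most 1 by
    the second one ([norm_Phi_le]). *)

(** * Positive definite matrices *)

Section Forms.
Variables (R : realFieldType) (n : nat).
Implicit Types (A B C G M P Q : 'M[R]_n) (u v w : 'cV[R]_n).

Definition dot u v : R := (u^T *m v) 0 0.

Lemma dotC u v : dot u v = dot v u.
Proof. by rewrite /dot -[u^T *m v]trmxK trmx_mul trmxK mxE. Qed.

Lemma dotDr u v w : dot u (v + w) = dot u v + dot u w.
Proof. by rewrite /dot mulmxDr mxE. Qed.

Lemma dotNr u v : dot u (- v) = - dot u v.
Proof. by rewrite /dot mulmxN mxE. Qed.

Lemma dotZr u v a : dot u (a *: v) = a * dot u v.
Proof. by rewrite /dot -scalemxAr mxE. Qed.

Lemma dotDl u v w : dot (v + w) u = dot v u + dot w u.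
Proof. by rewrite dotC dotDr dotC (dotC u w). Qed.

Lemma dotNl u v : dot (- v) u = - dot v u.
Proof. by rewrite dotC dotNr dotC. Qed.

Lemma dotZl u v a : dot (a *: v) u = a * dot v u.
Proof. by rewrite dotC dotZr dotC. Qed.

Lemma dot0r u : dot u 0 = 0.
Proof. by rewrite /dot mulmx0 mxE. Qed.

Lemma dot_mulmxl A u v : dot (A *m u) v = dot u (A^T *m v).
Proof. by rewrite /dot trmx_mul mulmxA. Qed.

Lemma dot_delta A (i j : 'I_n) :
  dot (delta_mx i 0) (A *m delta_mx j 0) = A i j.
Proof. by rewrite /dot trmx_delta -colE -rowE !mxE. Qed.

Lemma outer_mulmx u v w : (u *m v^T) *m w = dot v w *: u.
Proof.
by rewrite -mulmxA [v^T *m w]mx11_scalar -/(dot v w) mul_mx_scalar.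
Qed.

Lemma tr_outer u v : (u *m v^T)^T = v *m u^T.
Proof. by rewrite trmx_mul trmxK. Qed.

Lemma mxtrace_outer A u v : \tr (A *m (u *m v^T)) = dot v (A *m u).
Proof. by rewrite mulmxA mxtrace_mulC /mxtrace big_ord1. Qed.

Definition dotE := (mulmxDl, mulmxBl, mulmxDr, mulmxBr, mulmxN, mulNmx,
  =^~ scalemxAl, =^~ scalemxAr, outer_mulmx,
  dotDl, dotDr, dotNl, dotNr, dotZl, dotZr).

Definition psd A := A^T = A /\ forall u, 0 <= dot u (A *m u).
Definition pd A := A^T = A /\ forall u, u != 0 -> 0 < dot u (A *m u).

Lemma pd_psd A : pd A -> psd A.
Proof.
move=> [sA pA]; split=> // u; have [->|/pA/ltW//] := eqVneq u 0.
by rewrite mulmx0 dot0r.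
Qed.

Lemma psdD A B : psd A -> psd B -> psd (A + B).
Proof.
move=> [sA pA] [sB pB]; split=> [|u]; first by rewrite linearD /= sA sB.
by rewrite !dotE addr_ge0.
Qed.

Lemma psdZ a A : 0 <= a -> psd A -> psd (a *: A).
Proof.
move=> a0 [sA pA]; split=> [|u]; first by rewrite linearZ /= sA.
by rewrite !dotE mulr_ge0.
Qed.

Lemma pdD_psd A B : pd A -> psd B -> pd (A + B).
Proof.
move=> [sA pA] [sB pB]; split=> [|u u0]; first by rewrite linearD /= sA sB.
by rewrite !dotE ltr_wpDr ?pB ?pA.
Qed.

Lemma pdZ a A : 0 < a -> pd A -> pd (a *: A).
Proof.
move=> a0 [sA pA]; split=> [|u u0]; first by rewrite linearZ /= sA.
by rewrite !dotE mulr_gt0 ?pA.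
Qed.

Lemma psd_outer v : psd (v *m v^T).
Proof.
split=> [|u]; first by rewrite tr_outer.
by rewrite !dotE (dotC v) -expr2 sqr_ge0.
Qed.

Lemma psd_conj A C : psd A -> psd (C^T *m A *m C).
Proof.
move=> [sA pA]; split=> [|u]; first by rewrite !trmx_mul trmxK sA mulmxA.
by rewrite -!mulmxA -{1}[C]trmxK -dot_mulmxl trmxK.
Qed.

Lemma pd_unit A : pd A -> A \in unitmx.
Proof.
move=> [sA pA]; rewrite -row_free_unit -kermx_eq0; apply/eqP/row_matrixP => i.
rewrite row0; apply/eqP/negPn/negP => ri0.
have := pA (row i (kermx A))^T; rewrite -trmx0 (inj_eq trmx_inj) => /(_ ri0).
rewrite /dot trmxK mulmxA.
have -> : row i (kermx A) *m A = 0 by apply/sub_kermxP/row_sub.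
by rewrite mul0mx mxE ltxx.
Qed.

Lemma tr_invmx A : A^T = A -> (invmx A)^T = invmx A.
Proof. by move=> sA; rewrite trmx_inv sA. Qed.

Lemma pd_inv A : pd A -> pd (invmx A).
Proof.
move=> pdA; have uA := pd_unit pdA; have [sA pA] := pdA.
split=> [|u u0]; first exact: tr_invmx.
rewrite -{1}(mulKVmx uA u) dot_mulmxl sA (mulKVmx uA) dotC -{1}(mulKVmx uA u).
rewrite dotC pA //; apply: contra_neq u0 => e.
by rewrite -(mulKVmx uA u) e mulmx0.
Qed.

(** Cauchy-Schwarz inequality for a semi-inner product: the form is nonnegative
    at all combinations of [u] and [v]. *)
Lemma psd_CS A u v : psd A ->
  dot u (A *m v) ^+ 2 <= dot u (A *m u) * dot v (A *m v).
Proof.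
move=> [sA pA].
have sym : dot v (A *m u) = dot u (A *m v) by rewrite dotC dot_mulmxl sA.
have H s t : 0 <= s ^+ 2 * dot u (A *m u) + 2 * s * t * dot u (A *m v)
                  + t ^+ 2 * dot v (A *m v).
  have := pA (s *: u + t *: v); rewrite !dotE sym => h.
  by apply: le_trans h _; rewrite le_eqVlt; apply/orP; left; apply/eqP; ring.
have a0 := pA u; have c0 := pA v.
move: (dot u (A *m u)) (dot u (A *m v)) (dot v (A *m v)) H a0 c0 => a b c H a0.
rewrite le_eqVlt => /orP[/eqP c0|c0].
  (* A null vector [v]: a large enough multiple of it makes the cross term
     outweigh the square of [u]. *)
  rewrite -c0 mulr0; have := H b (- (a + 1)); rewrite -c0 => h.
  have : b ^+ 2 * (a + 2) <= 0 by nra.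
  by rewrite pmulr_lle0 // ltr_wpDl.
have := H c (- b) => h.
have : 0 <= c * (a * c - b ^+ 2).
  by apply: le_trans h _; rewrite le_eqVlt; apply/orP; left; apply/eqP; ring.
by rewrite pmulr_rge0 // subr_ge0.
Qed.

(** Duality between the norms of [A] and of its inverse: this is [psd_CS] for
    [u] and [invmx A *m v]. *)
Lemma pd_CS A u v : pd A ->
  dot u v ^+ 2 <= dot u (A *m u) * dot v (invmx A *m v).
Proof.
move=> pA; have uA := pd_unit pA.
have := psd_CS u (invmx A *m v) (pd_psd pA).
by rewrite (mulKVmx uA) (dotC (invmx A *m v)).
Qed.

Lemma dot_deltal (i : 'I_n) u : dot (delta_mx i 0) u = u i 0.
Proof. by rewrite /dot trmx_delta -rowE mxE. Qed.

Lemma psd_null A u : psd A -> dot u (A *m u) = 0 -> A *m u = 0.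
Proof.
move=> pA u0; apply/colP => i; have := psd_CS (delta_mx i 0) u pA.
rewrite u0 mulr0 exprn_even_le0 //= => /eqP; rewrite dot_deltal => ->.
by rewrite mxE.
Qed.

Lemma psd_unit_pd A : psd A -> A \in unitmx -> pd A.
Proof.
move=> pA uA; split=> [|u]; first exact: pA.1.
rewrite lt_neqAle (pA.2 u) andbT eq_sym; apply: contra_neq => uAu0.
have Au0 := psd_null pA (esym uAu0).
by rewrite -(mulKmx uA u) Au0 mulmx0.
Qed.
(** The diagonal entries of [P] are eliminated one after the other: a step of
    Cholesky's algorithm splits off a rank one matrix [a w w^T], [a >= 0], which
    contributes [a * dot w (Q *m w) >= 0] to the trace.  The induction is on the
    number of rows of [P] that may be nonzero. *)
Lemma psd_trace P Q : psd P -> psd Q -> 0 <= \tr (P *m Q).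
Proof.
move=> psdP psdQ; have [sQ pQ] := psdQ.
suff H k P' : psd P' -> (forall i j : 'I_n, (k <= i)%N -> P' i j = 0) ->
    0 <= \tr (P' *m Q).
  by apply: (H n) => // i j; rewrite leqNgt ltn_ord.
elim: k P' {P psdP} => [|k IHk] P psdP rP.
  suff -> : P = 0 by rewrite mul0mx mxtrace0.
  by apply/matrixP => i j; rewrite rP // mxE.
have [kn|kn] := ltnP k n; last first.
  by apply: IHk => // i j ki; have := leq_trans kn ki; rewrite leqNgt ltn_ord.
pose i0 := Ordinal kn; pose e : 'cV[R]_n := delta_mx i0 0.
have [sP pP] := psdP.
have rPi (i : 'I_n) j : (k <= i)%N -> i != i0 -> P i j = 0.
  move=> ki ii0; apply: rP; rewrite ltn_neqAle ki andbT.
  by apply: contra ii0 => /eqP e0; apply/eqP/val_inj.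
have Pe i : (P *m e) i 0 = P i i0 by rewrite -colE mxE.
have a0 : 0 <= P i0 i0 by rewrite -dot_delta.
move: a0; rewrite le_eqVlt => /orP[/eqP a0|a0].
  (* A zero diagonal entry forces a zero row, by Cauchy-Schwarz. *)
  apply: IHk => // i j ki; have [->|] := eqVneq i i0; last exact: rPi.
  have := psd_CS e (delta_mx j 0) psdP.
  by rewrite !dot_delta -a0 mul0r exprn_even_le0 //= => /eqP.
pose P' := P - (P i0 i0)^-1 *: ((P *m e) *m (P *m e)^T).
have trP : \tr (P *m Q) =
    \tr (P' *m Q) + (P i0 i0)^-1 * dot (P *m e) (Q *m (P *m e)).
  rewrite -mxtrace_outer (mxtrace_mulC Q) -mxtraceZ -mxtraceD; congr (\tr _).
  by rewrite mulmxBl -scalemxAl subrK.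
rewrite trP addr_ge0 ?mulr_ge0 ?invr_ge0 ?(ltW a0) //.
apply: IHk => [|i j ki].
  split=> [|u].
    by rewrite linearB /= linearZ /= tr_outer sP.
  rewrite !dotE subr_ge0 ler_pdivrMl // (dotC (P *m e)) -expr2.
  by rewrite -(dot_delta P) -/e mulrC psd_CS.
have -> : P' i j = P i j - (P i0 i0)^-1 * (P i i0 * P j i0).
  by rewrite !mxE big_ord1 [(P *m e)^T _ _]mxE !Pe.
have -> : P j i0 = P i0 j by rewrite -{1}sP mxE.
have [->|ii0] := eqVneq i i0; first by rewrite mulKf ?subrr ?gt_eqF.
by rewrite !(rPi i) // mul0r mulr0 subr0.
Qed.

(** In an orthonormal basis for [B] this is the bound of the largest eigenvalue
    of [G] by its trace.  Here it is [psd_trace] for [G] and the matrix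
    [dot w (B *m w) *: invmx B - w *m w^T], which is positive semidefinite by
    Cauchy-Schwarz. *)
Lemma psd_le_trace B G : pd B -> psd G ->
  psd (\tr (G *m invmx B) *: B - G).
Proof.
move=> pB pG; have [sB _] := pB; have [sG _] := pG.
split=> [|w]; first by rewrite linearB linearZ /= sB sG.
pose Q := dot w (B *m w) *: invmx B - w *m w^T.
have psdQ : psd Q.
  split=> [|u]; first by rewrite linearB linearZ /= tr_invmx // tr_outer.
  by rewrite !dotE (dotC u w) subr_ge0 -expr2 pd_CS.
have := psd_trace pG psdQ.
rewrite mulmxBr -scalemxAr linearB /= mxtraceZ mxtrace_outer !dotE.
by rewrite mulrC.
Qed.

(** With [w = invmx C *m u], Cauchy-Schwarz for [A] bounds the square of
    [dot u w] by [dot w (A *m w) * dot u (invmx A *m u)], where the first factor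
    is at most [dot w (C *m w) = dot u w]. *)
Lemma invmx_antitone A C : pd A -> psd (C - A) -> psd (invmx A - invmx C).
Proof.
move=> pA pCA; have pC : pd C by rewrite -(subrKC A C); exact: pdD_psd.
have [sA _] := pA; have [sC _] := pC; have uC := pd_unit pC.
split=> [|u]; first by rewrite linearB /= !tr_invmx.
have pAC w : dot w (A *m w) <= dot w (C *m w).
  by have := pCA.2 w; rewrite !dotE subr_ge0.
rewrite !dotE subr_ge0.
have := (pd_psd (pd_inv pC)).2 u; rewrite le_eqVlt => /orP[/eqP <-|d0].
  exact: (pd_psd (pd_inv pA)).2.
rewrite -(ler_pM2l d0) -expr2 -{1}(dotC (invmx C *m u)).
apply: le_trans (pd_CS _ _ pA) _; apply: ler_wpM2r.
  exact: (pd_psd (pd_inv pA)).2.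
by rewrite (le_trans (pAC _)) // mulKVmx // dotC.
Qed.

(** The Sherman-Morrison formula. *)
Lemma invmx_rank1 A u v (t := 1 + dot v (invmx A *m u)) :
  A \in unitmx -> t != 0 ->
  invmx (A + u *m v^T) =
    invmx A - t^-1 *: ((invmx A *m u) *m (v^T *m invmx A)).
Proof.
move=> uA t0; set X := (X in _ = X).
suff XA : (A + u *m v^T) *m X = 1%:M.
  have [uA' _] := mulmx1_unit XA.
  by rewrite -[LHS]mulmx1 -XA mulKmx.
have Aw : (A + u *m v^T) *m (invmx A *m u) = t *: u.
  by rewrite mulmxDl mulKVmx // outer_mulmx /t scalerDl scale1r.
rewrite mulmxBr -scalemxAr mulmxA Aw -scalemxAl scalerA mulVf // scale1r.
by rewrite mulmxDl mulmxV // -mulmxA addrK.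
Qed.

(** The matrix determinant lemma.  For [A = 1] the unipotent block matrices [L]
    and [U] turn the block matrix [M], whose determinant is that of
    [1 + u v^T], into a triangular matrix. *)
Lemma det_rank1 A u v : A \in unitmx ->
  \det (A + u *m v^T) = \det A * (1 + dot v (invmx A *m u)).
Proof.
move=> uA.
have -> : A + u *m v^T = A *m (1%:M + (invmx A *m u) *m v^T).
  by rewrite mulmxDr mulmx1 mulmxA mulKVmx.
rewrite det_mulmx; congr (_ * _); move: (invmx A *m u) => {}u.
pose L : 'M[R]_(n + 1) := block_mx 1%:M 0 v^T 1%:M.
pose U : 'M[R]_(n + 1) := block_mx 1%:M 0 (- v^T) 1%:M.
pose M : 'M[R]_(n + 1) := block_mx (1%:M + u *m v^T) u 0 1%:M.
have : \det (L *m M *m U) = \det (1%:M + u *m v^T).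
  by rewrite !det_mulmx !det_lblock det_ublock !det1 !(mul1r, mulr1).
rewrite /L /M /U !mulmx_block !(mulmx0, mul0mx, mul1mx, mulmx1, addr0, add0r).
rewrite mulmxN addrK.
have -> : v^T *m (1%:M + u *m v^T) + (v^T *m u + 1%:M) *m - v^T = 0.
  by rewrite mulmxN mulmxDr mulmxDl mulmx1 mul1mx mulmxA (addrC v^T) subrr.
rewrite det_ublock det1 mul1r => <-.
by rewrite [v^T *m u + _]mx11_scalar det_scalar1 mxE [1%:M _ _]mxE addrC.
Qed.

(** The effect on the determinant of a Gram matrix of replacing the vector [u]
    by [w]. *)
Lemma det_exchange M u (w : 'cV[R]_n) : pd M ->
  \det (M + w *m w^T - u *m u^T) = \det M *
    ((1 + dot w (invmx M *m w)) * (1 - dot u (invmx M *m u))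
      + dot w (invmx M *m u) ^+ 2).
Proof.
move=> pM; have uM := pd_unit pM; set D := invmx M.
have d0 : 0 <= dot w (D *m w) by exact: (pd_psd (pd_inv pM)).2.
have t0 : 1 + dot w (D *m w) != 0 by rewrite gt_eqF // ltr_pwDl.
have pM' : pd (M + w *m w^T) by apply: pdD_psd => //; exact: psd_outer.
rewrite -mulNmx det_rank1 ?pd_unit // det_rank1 // -mulrA; congr (_ * _).
have DT : D^T = D by exact: (pd_inv pM).1.
rewrite invmx_rank1 // -/D (_ : w^T *m D = (D *m w)^T); last first.
  by rewrite trmx_mul DT.
have sym : dot u (D *m w) = dot w (D *m u) by rewrite dotC dot_mulmxl DT.
have sym' : dot (D *m w) u = dot w (D *m u) by rewrite dot_mulmxl DT.
rewrite !dotE sym sym'.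
by field.
Qed.

End Forms.

(** * Gram matrices and the lower barrier *)

Section Gram.
Variables (R : realFieldType) (n : nat) (T : eqType) (v : T -> 'cV[R]_n).

Definition gram (s : seq T) : 'M[R]_n := \sum_(x <- s) v x *m (v x)^T.

Lemma gram_cons x s : gram (x :: s) = v x *m (v x)^T + gram s.
Proof. exact: big_cons. Qed.

Lemma gram_dot s u w :
  dot u (gram s *m w) = \sum_(x <- s) dot u (v x) * dot w (v x).
Proof.
elim: s => [|x s IHs]; first by rewrite /gram !big_nil mul0mx dot0r.
by rewrite gram_cons big_cons !dotE IHs (dotC w) mulrC.
Qed.

Lemma psd_gram s : psd (gram s).
Proof.
split=> [|u]; last first.
  by rewrite gram_dot sumr_ge0 // => x _; rewrite -expr2 sqr_ge0.
by rewrite /gram linear_sum; apply: eq_bigr => x _; rewrite /= tr_outer.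
Qed.

Lemma gram_cat s1 s2 : gram (s1 ++ s2) = gram s1 + gram s2.
Proof. exact: big_cat. Qed.

End Gram.

Section Barrier.
Variables (R : realFieldType) (n : nat) (T : eqType) (v : T -> 'cV[R]_n).
Variable G : 'M[R]_n.
(* This holds when [G] is an average of the matrices [v x *m (v x)^T]: the mean
   of the right-hand side is then [\tr (G *m Q)].  Stated in this form, it keeps
   the argument free of integrals. *)
Hypothesis avgG :
  forall Q, exists x, \tr (G *m Q) <= dot (v x) (Q *m v x).
Hypothesis pG : psd G.
Implicit Types (B M : 'M[R]_n).

(** One step of the lower barrier method.  Put [P = (B - G)^-1] and let
    [phi = \tr (G B^-1)] and [phi1 = \tr (G P)] be the barriers before and after
    the subtraction of [G].  By Sherman-Morrison, adding [2 w w^T] lowers the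
    barrier from [phi1] to at most [phi] as soon as
    [(phi1 - phi) (1/2 + dot w (P w)) <= dot w (P G P w)].  Averaging over [w]
    replaces the two forms by [phi1] and [\tr (G P G P)].  So it suffices that
    [phi1 <= 1/2], which holds because [phi <= 1/3] implies [G <= B / 3], hence
    [P <= (3/2) B^-1], and that [phi1 - phi <= \tr (G P G P)], which follows from
    [P - B^-1 = P G B^-1] and [B^-1 <= P]. *)
Lemma barrier_step B :
  pd B -> \tr (G *m invmx B) <= 3^-1 ->
  exists x, let B' := B - G + 2 *: (v x *m (v x)^T) in
    pd B' /\ \tr (G *m invmx B') <= 3^-1.
Proof.
move=> pB phi3; set phi := \tr _ in phi3.
have psd3 : psd (3^-1 *: B - G).
  have -> : 3^-1 *: B - G = (3^-1 - phi) *: B + (phi *: B - G).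
    by rewrite scalerBl addrA subrK.
  apply: psdD; last exact: psd_le_trace.
  by apply: psdZ; [rewrite subr_ge0 | exact: pd_psd].
have psd23 : psd ((B - G) - (2 / 3) *: B).
  suff -> : (B - G) - (2 / 3) *: B = 3^-1 *: B - G by [].
  rewrite addrAC; congr (_ - _); rewrite -[X in X - _]scale1r -scalerBl.
  by congr (_ *: _); field.
have p23 : pd ((2 / 3) *: B) by apply: pdZ => //; rewrite divr_gt0.
have pB1 : pd (B - G).
  by rewrite -(subrKC ((2 / 3) *: B) (B - G)); exact: pdD_psd.
have uB := pd_unit pB; have uB1 := pd_unit pB1.
pose Bi := invmx B; pose P := invmx (B - G).
have pP : pd P by exact: pd_inv.
have psdP32 : psd ((3 / 2) *: Bi - P).
  have := invmx_antitone p23 psd23; rewrite invmxZ ?pd_unit //.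
  by rewrite (_ : (2 / 3)^-1 = 3 / 2) //; field.
have psdPB : psd (P - Bi).
  by apply: invmx_antitone => //; rewrite opprB addrC subrK.
set phi1 := \tr (G *m P).
have phi1_le : phi1 <= 2^-1.
  have := psd_trace pG psdP32.
  rewrite mulmxBr -scalemxAr linearB /= mxtraceZ -/phi -/phi1; lra.
have phi_le : phi <= phi1.
  by have := psd_trace pG psdPB; rewrite mulmxBr linearB /= subr_ge0.
have resolvent : P - Bi = P *m G *m Bi.
  rewrite -[X in P - X](mulKmx uB1) -/P -[X in X - _]mulmx1 -mulmxBr -mulmxA.
  by congr (_ *m _); rewrite mulmxBl mulmxV // opprB addrC subrK.
have psdGPG : psd (G *m P *m G).
  by rewrite -{1}pG.1; exact/psd_conj/pd_psd.
have key : phi1 - phi <= \tr (G *m (P *m G *m P)).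
  have -> : phi1 - phi = \tr (G *m P *m G *m Bi).
    by rewrite -linearB -mulmxBr resolvent !mulmxA.
  by rewrite -subr_ge0 !mulmxA -linearB -mulmxBr; exact: psd_trace.
pose Q := P *m G *m P - (phi1 - phi) *: P.
have [x] := avgG Q; rewrite /Q mulmxBr linearB /= -scalemxAr mxtraceZ -/phi1.
rewrite !dotE => hx; exists x; set w := v x in hx *.
pose B' := B - G + 2 *: (w *m w^T).
set d := dot w (P *m w) in hx; have d0 : 0 <= d by exact: (pd_psd pP).2.
have pB' : pd B'.
  by apply: pdD_psd => //; apply: psdZ => //; exact: psd_outer.
split=> //; rewrite -/B'.
have t0 : 1 + 2 * d != 0 by rewrite gt_eqF // ltr_pwDl // mulr_ge0.
have -> : invmx B' = P - (2 / (1 + 2 * d)) *: ((P *m w) *m (P *m w)^T).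
  rewrite /B' scalemxAl invmx_rank1 ?dotE // -/P.
  by rewrite trmx_mul (pP.1) scalerA [_^-1 * 2]mulrC.
rewrite mulmxBr -scalemxAr linearB /= mxtraceZ mxtrace_outer -/phi1.
have -> : dot (P *m w) (G *m (P *m w)) = dot w (P *m G *m P *m w).
  by rewrite dot_mulmxl pP.1 !mulmxA.
move: hx key; set a := dot w _; set b := \tr _ => hx key.
apply: le_trans phi3; rewrite lerBlDr -lerBlDl mulrAC.
rewrite ler_pdivlMr ?ltr_pwDl ?mulr_ge0 //.
have : (phi1 - phi) * (1 - phi1 + d) <= a by nra.
have : 0 <= phi1 - phi by lra.
nra.
Qed.

Lemma barrier_points B k :
  pd B -> \tr (G *m invmx B) <= 3^-1 ->
  exists2 s, size s = k & pd (B - k%:R *: G + 2 *: gram v s).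
Proof.
move=> pB phi3.
suff [s [sz pBs _]] : exists s, [/\ size s = k,
    pd (B - k%:R *: G + 2 *: gram v s) &
    \tr (G *m invmx (B - k%:R *: G + 2 *: gram v s)) <= 3^-1] by exists s.
elim: k => [|k [s [sz pBs phis]]].
  by exists [::]; rewrite scale0r /gram big_nil scaler0 subr0 addr0.
have [x] := barrier_step pBs phis; set B' := _ + _.
rewrite [let _ := _ in _]/=.
suff -> : B' = B - k.+1%:R *: G + 2 *: gram v (x :: s).
  by move=> [? ?]; exists (x :: s) => /=; rewrite sz.
rewrite /B' gram_cons scalerDr [2 *: _ + 2 *: _]addrC addrA; congr (_ + _).
rewrite addrAC; congr (_ + _).
by rewrite -addrA -opprD -natr1 scalerDl scale1r.
Qed.

(** The start [B = M + 3 n G] has barrier at most [n / (3 n) = 1/3], since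
    [\tr (M B^-1) >= 0] and [\tr (B B^-1) = n]. *)
Lemma barrier_gram M :
  pd M -> (0 < n)%N ->
  exists2 s, size s = (4 * n)%N & psd (M + 2 *: gram v s - n%:R *: G).
Proof.
move=> pM n0; pose B := M + (3 * n)%:R *: G.
have n0' : 0 < (3 * n)%:R :> R by rewrite ltr0n muln_gt0.
have pB : pd B by apply: pdD_psd => //; exact: psdZ.
have : \tr (G *m invmx B) <= 3^-1.
  have := psd_trace (pd_psd pM) (pd_psd (pd_inv pB)).
  rewrite (_ : M = B - (3 * n)%:R *: G); last by rewrite addrK.
  rewrite mulmxBl -scalemxAl mulmxV ?pd_unit // linearB /= mxtraceZ mxtrace1.
  rewrite subr_ge0 -ler_pdivlMl // => /le_trans -> //.
  by rewrite natrM invfM mulfVK // pnatr_eq0 -lt0n.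
move=> /(barrier_points (4 * n) pB)[s sz ps]; exists s => //.
suff -> : M + 2 *: gram v s - n%:R *: G =
    B - (4 * n)%:R *: G + 2 *: gram v s by exact: pd_psd.
rewrite addrAC; congr (_ + _); rewrite /B -addrA -scalerBl -scaleNr.
congr (_ + _ *: _).
by rewrite !natrM; ring.
Qed.
End Barrier.

(** * D-optimal designs *)

Section Design.
Variables (R : realType) (n : nat) (T : eqType) (v : T -> 'cV[R]_n).
Hypothesis n_gt0 : (0 < n)%N.
Hypothesis indep : forall c, (forall x, dot c (v x) = 0) -> c = 0.

(** A positive semidefinite sum has the common null space of its terms, so
    adding [x] can only shrink the kernel of the Gram matrix, and it does so
    when [v x] is not orthogonal to that kernel. *)
Lemma gram_rank_cons (x : T) s : (\rank (gram v s) <= \rank (gram v (x :: s)))%N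
  /\ forall c : 'cV_n, gram v s *m c = 0 -> dot c (v x) != 0 ->
     (\rank (gram v s) < \rank (gram v (x :: s)))%N.
Proof.
have rk s1 : \rank (kermx (gram v s1)) = (n - \rank (gram v s1))%N.
  exact: mxrank_ker.
have le_n s1 : (\rank (gram v s1) <= n)%N by exact: rank_leq_row.
have nullx c : gram v (x :: s) *m c = 0 -> dot c (v x) = 0 /\ gram v s *m c = 0.
  move=> c0; have : dot c (gram v (x :: s) *m c) = 0 by rewrite c0 dot0r.
  rewrite gram_cons !dotE (dotC (v x)) -expr2 => /eqP.
  rewrite paddr_eq0 ?sqr_ge0 ?(psd_gram v s).2 //.
  rewrite sqrf_eq0 => /andP[/eqP-> /eqP e0].
  by rewrite (psd_null _ e0) //; exact: psd_gram.
have sym s1 (r : 'rV_n) : (r *m gram v s1 == 0) = (gram v s1 *m r^T == 0).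
  by rewrite -(inj_eq trmx_inj) trmx0 trmx_mul (psd_gram v s1).1.
have ker_sub : (kermx (gram v (x :: s)) <= kermx (gram v s))%MS.
  apply/row_subP => i; apply/sub_kermxP/eqP; rewrite sym.
  apply/eqP/(fun h => (nullx _ h).2)/eqP; rewrite -sym; apply/eqP/sub_kermxP.
  exact: row_sub.
split=> [|c c0 cx].
  have := mxrankS ker_sub; rewrite !rk; have := le_n s; have := le_n (x :: s).
  by lia.
have : (kermx (gram v (x :: s)) < kermx (gram v s))%MS.
  rewrite ltmxE ker_sub; apply/negP => /(submx_trans (_ : (c^T <= _)%MS)).
  have -> : (c^T <= kermx (gram v s))%MS.
    by apply/sub_kermxP/eqP; rewrite sym trmxK c0.
  move=> /(_ isT) /sub_kermxP/eqP; rewrite sym trmxK => /eqP /nullx[/eqP].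
  by rewrite (negbTE cx).
move=> /rank_ltmx; rewrite !rk; have := le_n s; have := le_n (x :: s).
by lia.
Qed.

(** As long as the Gram matrix is singular, a vector [c] of its kernel is
    nonzero, hence by [indep] not orthogonal to all [v x], and some point
    increases the rank. *)
Lemma exists_pd_gram (p : T) : exists2 s, size s = n & pd (gram v s).
Proof.
suff H k : (k <= n)%N -> exists2 s, size s = k & (k <= \rank (gram v s))%N.
  have [s sz rk] := H n (leqnn n).
  exists s => //; apply: psd_unit_pd; first exact: psd_gram.
  by rewrite -row_full_unit /row_full eqn_leq rank_leq_row.
elim: k => [|k IHk] kn; first by exists [::].
have [s sz rk] := IHk (ltnW kn).
have [kr|rk'] := ltnP k (\rank (gram v s)).
  exists (p :: s); rewrite /= ?sz // (leq_trans kr) //.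
  exact: (gram_rank_cons p s).1.
have : kermx (gram v s) != 0.
  rewrite -mxrank_eq0 mxrank_ker subn_eq0 -ltnNge; exact: leq_ltn_trans kn.
move=> /rowV0Pn[r /sub_kermxP r0 rn0].
have /existsNP[x /eqP rx] : ~ forall x, dot r^T (v x) = 0.
  move=> /indep /eqP; rewrite -trmx0 (inj_eq trmx_inj); exact/negP.
exists (x :: s); rewrite /= ?sz //; apply: leq_ltn_trans rk _.
apply: (gram_rank_cons x s).2 rx.
by apply: trmx_inj; rewrite trmx_mul trmxK (psd_gram v s).1 r0 trmx0.
Qed.

Lemma norm_det_gram_le C m : (forall x i, `|v x i 0| <= C) ->
  exists D, forall s, size s = m -> `|\det (gram v s)| <= D.
Proof.
move=> vC; exists (\sum_(sg : 'S_n) \prod_(i < n) (m%:R * C ^+ 2)) => s sz.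
apply: le_trans (ler_norm_sum _ _ _) _; apply: ler_sum => sg _.
rewrite normrM normrX normrN1 expr1n mul1r normr_prod.
apply: ler_prod => i _; rewrite normr_ge0 /=.
rewrite -dot_delta gram_dot -sz -sum1_size natr_sum mulr_suml.
apply: le_trans (ler_norm_sum _ _ _) _; apply: ler_sum => x _.
rewrite !dot_deltal mul1r normrM expr2; exact: ler_pM.
Qed.

(** Take [s] of size [m = 2 n] whose determinant is within a factor
    [1 + eta], [eta = 1 / m], of the supremum; the supremum need not be attained.
    Write [d] for [dot w (M^-1 w)] with [w = v x], [d_y] for the same quantity at
    a point [y] of [s], and [d_xy] for the mixed one.  By [det_exchange],
    replacing [y] by [x] gives [(1 + d) (1 - d_y) + d_xy^2 <= 1 + eta].  The
    [d_y] sum to [\tr (M^-1 M) = n] and the [d_xy^2] to [d], so summation over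
    [y] gives [(n + 1) d <= n + 1]. *)
Lemma optimal_design (p : T) C : (forall x i, `|v x i 0| <= C) ->
  exists s, [/\ size s = (2 * n)%N, pd (gram v s) &
    forall x, dot (v x) (invmx (gram v s) *m v x) <= 1].
Proof.
move=> vC; pose m := (2 * n)%N.
have [D hD] := norm_det_gram_le m vC.
pose E := [set `|\det (gram v s)| | s in [set s | size s = m]].
have [s0 sz0 ps0] := exists_pd_gram p.
pose d0 := `|\det (gram v (s0 ++ s0))|.
have Ed0 : E d0.
  by exists (s0 ++ s0) => //=; rewrite size_cat sz0 /m mul2n addnn.
have d0_gt0 : 0 < d0.
  rewrite normr_gt0 -unitfE -unitmxE pd_unit // gram_cat.
  by apply: pdD_psd => //; exact: pd_psd.
have supE : has_sup E.
  by split; [exists d0 | exists D => _ [s sz <-]; exact: hD].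
have S0 : 0 < sup E by apply: lt_le_trans d0_gt0 _; exact: sup_upper_bound.
pose eta : R := m%:R^-1.
have m0 : 0 < m%:R :> R by rewrite ltr0n /m muln_gt0.
have eta0 : 0 < eta by rewrite invr_gt0.
have : 0 < sup E - sup E / (1 + eta).
  rewrite subr_gt0 ltr_pdivrMr ?ltr_pwDl ?(ltW eta0) //.
  by rewrite -subr_gt0 mulrDr mulr1 addrC addKr mulr_gt0.
move=> /(@sup_adherent _ E)/(_ supE)[_ [s sz <-]].
rewrite opprB addrC subrK => near.
set M := gram v s in near *.
have detM : 0 < `|\det M|.
  by apply: le_lt_trans near; rewrite divr_ge0 ?addr_ge0 ?ltW.
have pM : pd M.
  apply: psd_unit_pd; first exact: psd_gram.
  by rewrite unitmxE unitfE -normr_gt0.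
exists s; split=> // x; set w := v x.
pose Mi := invmx M; pose d := dot w (Mi *m w).
have exch y : y \in s ->
    (1 + d) * (1 - dot (v y) (Mi *m v y)) + dot w (Mi *m v y) ^+ 2 <= 1 + eta.
  move=> ys; set f := _ + _.
  have Ms' : gram v (x :: rem y s) = M + w *m w^T - v y *m (v y)^T.
    rewrite gram_cons addrAC addrC; congr (_ + _).
    by rewrite /M /gram (perm_big _ (perm_to_rem ys)) big_cons addrC addKr.
  have : `|\det (gram v (x :: rem y s))| <= sup E.
    apply: sup_upper_bound => //; exists (x :: rem y s) => //=.
    by rewrite size_rem // sz prednK // /m muln_gt0.
  rewrite Ms' det_exchange // normrM -/M -/Mi -/d -/f => fE.
  apply: le_trans (ler_norm f) _; rewrite -(ler_pM2l detM).
  apply: le_trans fE _; move: near.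
  by rewrite ltr_pdivrMr ?ltr_pwDl ?(ltW eta0) // => /ltW.
have sum_d : \sum_(y <- s) dot (v y) (Mi *m v y) = n%:R.
  have <- : \tr (Mi *m M) = n%:R by rewrite mulVmx ?pd_unit // mxtrace1.
  rewrite /M /gram mulmx_sumr raddf_sum /=.
  by apply: eq_bigr => y _; rewrite mxtrace_outer.
have sum_d2 : \sum_(y <- s) dot w (Mi *m v y) ^+ 2 = d.
  have -> : d = dot (Mi *m w) (M *m (Mi *m w)).
    by rewrite mulKVmx ?pd_unit // dotC.
  rewrite gram_dot; apply: eq_bigr => y _.
  by rewrite dot_mulmxl (pd_inv pM).1 expr2.
have : \sum_(y <- s)
      ((1 + d) * (1 - dot (v y) (Mi *m v y)) + dot w (Mi *m v y) ^+ 2) <=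
    \sum_(y <- s) (1 + eta).
  by rewrite big_seq [leRHS]big_seq; apply: ler_sum.
have sum1 (a : R) : \sum_(y <- s) a = m%:R * a.
  rewrite -sz -sum1_size natr_sum mulr_suml.
  by apply: eq_bigr => y _; rewrite mul1r.
rewrite big_split /= sum_d2 -mulr_sumr sumrB sum_d !sum1 mulr1.
rewrite [leRHS]mulrDr mulr1 mulfV ?gt_eqF // /m natrM => h.
have : (n%:R + 1) * d <= (n%:R + 1) * 1.
  by lra.
by rewrite ler_pM2l // ltr_wpDl.
Qed.
End Design.

(** * Discretization with respect to a probability measure *)

Lemma dot_quadE (R : realFieldType) n (u : 'cV[R]_n) (Q : 'M[R]_n) :
  dot u (Q *m u) = \sum_(p : 'I_n * 'I_n) Q p.1 p.2 * (u p.1 0 * u p.2 0).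
Proof.
rewrite /dot mxE -(pair_bigA _ (fun i j => Q i j * (u i 0 * u j 0))) /=.
apply: eq_bigr => i _; rewrite !mxE mulr_sumr; apply: eq_bigr => j _.
by ring.
Qed.

Section Sampling.
Variables (R : realType) (d : measure_display) (T : measurableType d).
Variable mu : probability T R.

Section Moments.
Variables (n : nat) (v : T -> 'cV[R]_n) (C : R).
Hypothesis v_meas : forall i, measurable_fun setT (fun x => v x i 0).
Hypothesis v_bound : forall x i, `|v x i 0| <= C.

Definition moment : 'M[R]_n := \matrix_(i, j) \int[mu]_x (v x i 0 * v x j 0).

Lemma tr_moment : moment^T = moment.
Proof.
apply/matrixP => i j; rewrite !mxE; apply: eq_Rintegral => x _.
by rewrite mulrC.
Qed.

Lemma integrable_vv i j : mu.-integrable setT (fun x => (v x i 0 * v x j 0)%:E).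
Proof.
apply: (@measurable_bounded_integrable _ _ _ mu
  (fun x => v x i 0 * v x j 0)) => //.
- by apply: le_lt_trans (probability_le1 mu measurableT) _; rewrite ltry.
- exact: measurable_funM.
exists (C * C); split; first exact: num_real.
move=> M CM x _ /=; apply: le_trans (ltW CM).
by rewrite normrM; apply: ler_pM.
Qed.

Lemma integrable_quad Q :
  mu.-integrable setT (fun x => (dot (v x) (Q *m v x))%:E).
Proof.
under eq_fun do rewrite dot_quadE -sumEFin.
apply: integrable_sum => //= p _; under eq_fun do rewrite EFinM.
by apply: integrableZl => //; exact: integrable_vv.
Qed.

Lemma integral_quad Q :
  (\int[mu]_x (dot (v x) (Q *m v x))%:E = (\tr (moment *m Q))%:E)%E.
Proof.
under eq_integral do rewrite dot_quadE -sumEFin.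
rewrite integral_sum //=; last first.
  move=> p; under eq_fun do rewrite EFinM.
  by apply: integrableZl => //; exact: integrable_vv.
rewrite mxtrace_mulC /mxtrace; under [in RHS]eq_bigr do rewrite mxE.
rewrite pair_bigA /= -sumEFin; apply: eq_bigr => -[i j] _ /=.
under eq_integral do rewrite EFinM.
rewrite integralZl //; last exact: integrable_vv.
rewrite -[in RHS]tr_moment !mxE EFinM /Rintegral fineK //.
by apply: integrable_fin_num => //; exact: integrable_vv.
Qed.

(** A bounded function is somewhere at least its mean: otherwise the integral
    of a positive function would vanish. *)
Lemma moment_average Q : exists x, \tr (moment *m Q) <= dot (v x) (Q *m v x).
Proof.
apply: contrapT => /forallNP lt_t; set t := \tr _ in lt_t.
have {}lt_t x : dot (v x) (Q *m v x) < t by rewrite ltNge; apply/negP.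
have int_t : mu.-integrable setT (cst t%:E).
  by apply: finite_measure_integrable_cst.
pose h x : \bar R := (t%:E - (dot (v x) (Q *m v x))%:E)%E.
have int_h : mu.-integrable setT h.
  by apply: integrableB => //; exact: integrable_quad.
have h0 : (\int[mu]_x `|h x| = 0)%E.
  under eq_integral => x _.
    rewrite gee0_abs; last by rewrite /h -EFinB lee_fin subr_ge0 ltW.
    over.
  rewrite integralB //; last exact: integrable_quad.
  rewrite integral_quad integral_cst //.
  rewrite [X in (_ * X)%E](@probability_setT _ _ _ mu) mule1.
  by rewrite subee.
have /ae_eq_integral_abs : measurable_fun setT h by case/integrableP: int_h.
move=> /(_ mu measurableT)[/(_ h0) + _] => -[N [mN N0 sN]].
have : (mu setT <= mu N)%E.
  apply: le_measure; rewrite ?inE //; apply: subset_trans sN => x _ /=.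
  move=> /(_ I)/eqP; rewrite /h -EFinB eqe subr_eq0 => /eqP e.
  by have := lt_t x; rewrite -e ltxx.
by rewrite N0 [X in (X <= _)%E](@probability_setT _ _ _ mu) lee_fin ler10.
Qed.

Lemma psd_moment : psd moment.
Proof.
split=> [|u]; first exact: tr_moment.
have [x] := moment_average (- (u *m u^T)).
rewrite mulmxN linearN /= mxtrace_outer mulNmx dotNr lerN2.
move=> /(le_trans _); apply.
by rewrite !dotE (dotC u) -expr2 sqr_ge0.
Qed.

Lemma integral_sqr_dot c :
  (\int[mu]_x (dot c (v x) ^+ 2)%:E = (dot c (moment *m c))%:E)%E.
Proof.
rewrite -mxtrace_outer -integral_quad; apply: eq_integral => x _.
by rewrite !dotE (dotC (v x)) expr2.
Qed.
End Moments.

(** The [2 n] points of a design [s1] and the [4 n] barrier points [s2] started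
    from its Gram matrix.  The latter enter with weight 2, so [n] times the
    integral is at most twice the sum over all [6 n] points, and
    [2 / n = 12 / (6 n)]. *)
Lemma sampling_indep n (v : T -> 'cV[R]_n) C : (0 < n)%N ->
  (forall i, measurable_fun setT (fun x => v x i 0)) ->
  (forall x i, `|v x i 0| <= C) ->
  (forall c, (forall x, dot c (v x) = 0) -> c = 0) ->
  exists2 s : seq T, size s = (6 * n)%N & forall c,
    (forall x, dot c (v x) ^+ 2 <= \sum_(y <- s) dot c (v y) ^+ 2) /\
    (\int[mu]_x (dot c (v x) ^+ 2)%:E <=
      (12 / (size s)%:R * \sum_(y <- s) dot c (v y) ^+ 2)%:E)%E.
Proof.
move=> n0 v_meas v_bound indep.
have [s1 [sz1 ps1 d1]] := optimal_design n0 indep point v_bound.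
have [s2 sz2 ps2] := barrier_gram (moment_average v_meas v_bound)
  (psd_moment v_meas v_bound) ps1 n0.
have szs : size (s1 ++ s2) = (6 * n)%N by rewrite size_cat sz1 sz2 -mulnDl.
exists (s1 ++ s2) => // c.
have gramE s : \sum_(y <- s) dot c (v y) ^+ 2 = dot c (gram v s *m c).
  by rewrite gram_dot; apply: eq_bigr => y _; rewrite expr2.
have sq0 s : 0 <= \sum_(y <- s) dot c (v y) ^+ 2.
  by apply: sumr_ge0 => y _; exact: sqr_ge0.
split=> [x|].
  rewrite big_cat /= ler_wpDr // gramE.
  apply: le_trans (pd_CS c (v x) ps1) _.
  by rewrite ler_piMr ?(pd_psd ps1).2.
rewrite (integral_sqr_dot v_meas v_bound) lee_fin szs big_cat /=.
have := ps2.2 c; rewrite !dotE subr_ge0 -!gramE.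
move: (sq0 s1) (sq0 s2); set a := \sum_(y <- s1) _; set b := \sum_(y <- s2) _.
move=> a0 b0 h.
have n0' : 0 < n%:R :> R by rewrite ltr0n.
have -> : 12 / (6 * n)%:R * (a + b) = (2 * (a + b)) / n%:R.
  by rewrite natrM; field; rewrite gt_eqF.
by rewrite ler_pdivlMr // mulrC; lra.
Qed.

(** The coordinates of [v] may be linearly dependent, as happens for the real
    and imaginary parts of a basis.  A relation [dot a (v x) = 0] with
    [a k 0 != 0] makes it possible to drop the coordinate [k]. *)
Lemma sampling n (v : T -> 'cV[R]_n) C : (0 < n)%N ->
  (forall i, measurable_fun setT (fun x => v x i 0)) ->
  (forall x i, `|v x i 0| <= C) ->
  exists2 s : seq T, (0 < size s <= 6 * n)%N & forall c,
    (forall x, dot c (v x) ^+ 2 <= \sum_(y <- s) dot c (v y) ^+ 2) /\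
    (\int[mu]_x (dot c (v x) ^+ 2)%:E <=
      (12 / (size s)%:R * \sum_(y <- s) dot c (v y) ^+ 2)%:E)%E.
Proof.
elim: n v => [//|n IHn] v _ v_meas v_bound.
have [indep|] := pselect (forall c, (forall x, dot c (v x) = 0) -> c = 0).
  have [s sz Hs] := sampling_indep (ltn0Sn n) v_meas v_bound indep.
  by exists s; rewrite // sz leqnn muln_gt0.
move=> /existsNP[a /not_implyP[a0 /eqP/matrix0Pn[k [j ak]]]].
rewrite {j}(ord1 j) in ak.
pose w x : 'cV[R]_n := row' k (v x).
pose red (c : 'cV[R]_n.+1) : 'cV[R]_n := row' k (c - (c k 0 / a k 0) *: a).
have dotS c x : dot c (v x) = dot (red c) (w x).
  have -> : dot c (v x) = dot (c - (c k 0 / a k 0) *: a) (v x).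
    by rewrite !dotE a0 mulr0 oppr0 addr0.
  rewrite /dot !mxE (bigD1_ord k) //= !mxE divfK // subrr mul0r add0r.
  by apply: eq_bigr => i _; rewrite !mxE.
(* No coordinate is left: all functions vanish and any point will do. *)
have [n0|n0] := posnP n.
  exists [:: point] => // c; have dot0 x : dot c (v x) = 0.
    rewrite dotS; move: (red c) (w x); rewrite n0 => r r'.
    by rewrite [r']flatmx0 dot0r.
  split=> [x|].
    by rewrite dot0 expr0n sumr_ge0 // => y _; rewrite sqr_ge0.
  under eq_integral do rewrite dot0 expr0n.
  rewrite integral0 lee_fin mulr_ge0 ?divr_ge0 ?sumr_ge0 // => y _.
  exact: sqr_ge0.
have [|x i|s sz Hs] := IHn w n0.
- move=> i; rewrite (_ : (fun x => w x i 0) = fun x => v x (lift k i) 0) //.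
  by apply/funext => x; rewrite mxE.
- by rewrite mxE.
exists s.
  by case/andP: sz => -> /leq_trans ->//; rewrite leq_mul2l leqnSn.
move=> c; have [H1 H2] := Hs (red c).
under eq_bigr do rewrite dotS.
split=> [x|]; first by rewrite dotS.
by under eq_integral do rewrite dotS.
Qed.
End Sampling.

(** * Continuous functions on a compact set *)

(** Compactness is known for [A] as a subset of [X], so [f] is first extended
    to [X], by a constant outside [A]. *)
Lemma continuous_set_type_bounded (R : realType) (X : topologicalType)
    (A : set X) (f : set_type A -> R) :
  compact A -> continuous f -> exists C, forall x, `|f x| <= C.
Proof.
move=> cA cf.
have [[p _]|noA] := pselect (exists p : set_type A, True); last first.
  by exists 0 => x; case: noA; exists x.
pose g x : R := f (insubd p x).
have gf x : g (\val x) = f x by rewrite /g valKd.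
have gA : {within A, continuous g}.
  apply/subspace_sigL_continuousP; rewrite (_ : sigL A g = f) //.
  by apply/funext => x; rewrite /sigL /= gf.
have [M [_ HM]] := compact_bounded (continuous_compact gA cA).
exists (M + 1) => x; rewrite -gf; apply: (HM (M + 1)); first by rewrite ltrDl.
by exists (\val x) => //; exact: set_valP.
Qed.

Lemma continuous_borel_measurable (R : realType) (T : ptopologicalType)
    (f : T -> R) : continuous f -> measurable_fun setT (f : borel T -> R).
Proof.
move=> /continuousP cf; apply: (measurability _ (RGenOpens.measurableE R)).
move=> _ [_ [a [b ->] <-]]; rewrite setTI; apply: sub_sigma_algebra.
exact/cf/interval_open.
Qed.

(** * Real and complex scalars *)

Section ScalarParts.
Variables (R : realType).

(** What the reduction to real functions uses of the scalar field; real scalars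
    satisfy it with [im = 0]. *)
Record scalar_parts (F : numFieldType) (modulus re im : F -> R) : Prop := {
  modulus_ge0 : forall z, 0 <= modulus z;
  sqr_modulus : forall z, modulus z ^+ 2 = re z ^+ 2 + im z ^+ 2;
  re_sum : forall I (s : seq I) (z : I -> F),
    re (\sum_(i <- s) z i) = \sum_(i <- s) re (z i);
  im_sum : forall I (s : seq I) (z : I -> F),
    im (\sum_(i <- s) z i) = \sum_(i <- s) im (z i);
  reM : forall z w, re (z * w) = re z * re w - im z * im w;
  imM : forall z w, im (z * w) = re z * im w + im z * re w;
  re_continuous : forall (T : topologicalType) (f : T -> F^o),
    continuous f -> continuous (re \o f);
  im_continuous : forall (T : topologicalType) (f : T -> F^o),
    continuous f -> continuous (im \o f) }.

Lemma complex_contraction_continuous (phi : R[i] -> R) (T : topologicalType)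
    (f : T -> R[i]^o) :
  (forall z w, phi (z - w) = phi z - phi w) ->
  (forall z, `|phi z|%:C%C <= `|z|) ->
  continuous f -> continuous (phi \o f).
Proof.
move=> phiB phi_le cf x; apply/cvgrPdist_lt => e e0.
have /cvgrPdist_lt/(_ e%:C%C) := cf x; rewrite ltcR => /(_ e0).
apply: filterS => y fy /=; rewrite -phiB -ltcR.
exact: le_lt_trans fy.
Qed.

Lemma scalar_partsP (F : numFieldType) (modulus : F -> R) :
  scalar_field modulus -> exists re im, scalar_parts modulus re im.
Proof.
case.
  exists id, (fun=> 0); split => //.
  - by move=> z; rewrite real_normK ?num_real // expr0n addr0.
  - by move=> I s z; rewrite big1.
  - by move=> z w; rewrite mul0r subr0.
  - by move=> z w; rewrite mulr0 mul0r addr0.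
  - by move=> T f _; exact: cst_continuous.
exists (@complex.Re R), (@complex.Im R); split.
- by case=> a b /=; exact: sqrtr_ge0.
- by case=> a b /=; rewrite sqr_sqrtr // addr_ge0 ?sqr_ge0.
- by move=> I s z; rewrite raddf_sum.
- by move=> I s z; rewrite raddf_sum.
- by case=> a b [c d].
- by case=> a b [c d] /=; rewrite addrC [b * c]mulrC addrC.
- move=> T f; apply: complex_contraction_continuous; last exact: normc_ge_Re.
  by move=> z w; rewrite raddfB.
- move=> T f; apply: complex_contraction_continuous.
    by move=> z w; rewrite raddfB.
  move=> [a b]; rewrite normc_def lecR /= -sqrtr_sqr.
  by rewrite ler_sqrt ?addr_ge0 ?sqr_ge0 // lerDr sqr_ge0.
Qed.

End ScalarParts.

(** The coordinates of [v] are the real and imaginary parts of a basis.  If [f]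
    has coefficients [c] in this basis, then its real and imaginary parts have
    coefficients [(re c, - im c)] and [(im c, re c)] with respect to [v]. *)
Lemma real_coordinates (R : realType) (F : numFieldType) (modulus : F -> R)
    (T : topologicalType) N (X : set (T -> F)) : scalar_field modulus ->
  X `<=` @C_space F T -> subspace_of_dim N X ->
  exists v : T -> 'cV[R]_(N + N), (forall i, continuous (fun x => v x i 0)) /\
    forall f, X f -> exists c1 c2, forall x,
      modulus (f x) ^+ 2 = dot c1 (v x) ^+ 2 + dot c2 (v x) ^+ 2.
Proof.
move=> /scalar_partsP[re [im parts]] XC [b [_ Xb]].
have cb i : continuous (b i : T -> F^o).
  apply: XC; rewrite Xb; exists (fun j => (j == i)%:R); apply/funext => x.
  rewrite (bigD1 i) //= eqxx mul1r big1 ?addr0 // => j /negbTE ->.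
  by rewrite mul0r.
exists (fun x => col_mx (\col_i re (b i x)) (\col_i im (b i x))); split.
  move=> i; case: (split_ordP i) => j ->.
    rewrite (_ : (fun x => _) = re \o b j); last first.
      by apply/funext => x; rewrite col_mxEu mxE.
    exact: re_continuous parts _ _ (cb j).
  rewrite (_ : (fun x => _) = im \o b j); last first.
    by apply/funext => x; rewrite col_mxEd mxE.
  exact: im_continuous parts _ _ (cb j).
move=> f; rewrite Xb => -[c ->].
exists (col_mx (\col_i re (c i)) (\col_i - im (c i))).
exists (col_mx (\col_i im (c i)) (\col_i re (c i))) => x.
rewrite (sqr_modulus parts) (re_sum parts) (im_sum parts).
congr (_ ^+ 2 + _ ^+ 2).
  rewrite /dot tr_col_mx mul_row_col !mxE -big_split; apply: eq_bigr => i _ /=.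
  by rewrite !mxE (reM parts) mulNr.
rewrite /dot tr_col_mx mul_row_col !mxE -big_split; apply: eq_bigr => i _ /=.
by rewrite !mxE (imM parts) addrC.
Qed.

(** * The Orlicz norm *)

Section Orlicz.
Variables (R : realType) (d : measure_display) (T : measurableType d).
Variables (mu : probability T R) (Phi : R -> R).
Hypothesis PhiP : Phi_function Phi.

(** [Phi] is compared with the square pointwise, for which [modulus (f x) / lam]
    has to stay in the range, up to [r], of the inequality for [Phi]. *)
Lemma norm_Phi_le (F : Type) (modulus : F -> R) (f : T -> F) (K r lam : R) :
  (forall z, 0 <= modulus z) ->
  measurable_fun setT (fun x => modulus (f x) ^+ 2) ->
  0 < K -> 0 < lam ->
  (forall t, 0 < t <= r -> Phi (K^-1 * t) <= t ^+ 2) ->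
  (forall x, modulus (f x) <= r * lam) ->
  (\int[mu]_x (modulus (f x) ^+ 2)%:E <= (lam ^+ 2)%:E)%E ->
  (norm_Phi modulus Phi mu f <= (K * lam)%:E)%E.
Proof.
move=> mod0 mf K0 lam0 PhiK f_le int_le.
apply: ereal_inf_lbound; exists (K * lam) => //=; split; first exact: mulr_gt0.
(* A monotone function of the whole line, hence measurable; composing it with
   the squared modulus avoids discussing [modulus] itself. *)
pose Psi s := Phi (Num.sqrt s / (K * lam)).
have Klam : 0 <= (K * lam)^-1 by rewrite invr_ge0 ltW // mulr_gt0.
have mPsi : measurable_fun setT Psi.
  apply: nondecreasing_measurable => // s t st; apply: (Phi_incr PhiP).
    by rewrite mulr_ge0 // sqrtr_ge0.
  by rewrite ler_wpM2r // ler_wsqrtr.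
have PsiE x : Phi (modulus (f x) / (K * lam)) = Psi (modulus (f x) ^+ 2).
  by rewrite /Psi sqrtr_sqr ger0_norm.
apply: (@le_trans _ _
  (\int[mu]_x ((lam ^- 2)%:E * (modulus (f x) ^+ 2)%:E)%E)%E).
  apply: ge0_le_integral => //.
  - by move=> x _; rewrite lee_fin (Phi_ge0 PhiP) // mulr_ge0.
  - under eq_fun do rewrite PsiE.
    apply/measurable_EFinP; exact: (measurableT_comp mPsi mf).
  - apply/measurable_EFinP; exact: measurable_funM.
  move=> x _; rewrite -EFinM lee_fin.
  have -> : modulus (f x) / (K * lam) = K^-1 * (modulus (f x) / lam).
    by rewrite invfM mulrCA.
  have -> : lam ^- 2 * modulus (f x) ^+ 2 = (modulus (f x) / lam) ^+ 2.
    by rewrite expr_div_n mulrC.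
  have := mod0 (f x); rewrite le_eqVlt => /orP[/eqP <-|fx0].
    by rewrite !(mul0r, mulr0) (Phi_at0 PhiP) expr0n.
  by apply: PhiK; rewrite divr_gt0 //= ler_pdivrMr.
rewrite ge0_integralZl //; last 3 first.
- exact/measurable_EFinP.
- by move=> x _; rewrite lee_fin sqr_ge0.
- by rewrite lee_fin invr_ge0 exprn_ge0 // ltW.
apply: (@le_trans _ _ ((lam ^- 2)%:E * (lam ^+ 2)%:E)%E).
  by rewrite lee_pmul2l // lte_fin invr_gt0 exprn_gt0.
by rewrite -EFinM mulVf // expf_neq0 // gt_eqF.
Qed.

Lemma norm_Phi_eq0 (F : Type) (modulus : F -> R) (f : T -> F) :
  (forall x, modulus (f x) = 0) -> (norm_Phi modulus Phi mu f <= 0)%E.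
Proof.
move=> f0; apply/lee_addgt0Pr => e e0; rewrite add0e; apply: ereal_inf_lbound.
exists e => //=; split => //.
under eq_integral do rewrite f0 mul0r (Phi_at0 PhiP).
by rewrite integral0 lee_fin ler01.
Qed.
End Orlicz.

Lemma Phi_le_sqr (R : realType) (Phi : R -> R) (K r : R) :
  (ereal_sup [set (Phi (K^-1 * t) / t ^+ 2)%:E
             | t in [set t : R | (0 < t <= r)%R]] < 1)%E ->
  forall t, 0 < t <= r -> Phi (K^-1 * t) <= t ^+ 2.
Proof.
move=> sup1 t tr; have t0 : 0 < t by case/andP: tr.
have : ((Phi (K^-1 * t) / t ^+ 2)%:E <= 1)%E.
  by apply: le_trans (ltW sup1); apply: ereal_sup_ubound; exists t.
by rewrite lee_fin ler_pdivrMr ?exprn_gt0 // mul1r.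
Qed.

Theorem theorem5p6 (R : realType) :
  exists c1 c2 : R, 0 < c1 /\ 0 < c2 /\
  forall (Phi : R -> R) (K : nat -> R),
  Phi_function Phi ->
  (forall N : nat, (1 <= N)%N ->
     0 < K N /\
     (ereal_sup [set (Phi ((K N)^-1 * t) / t ^+ 2)%:E
                | t in [set t : R | (0 < t <= Num.sqrt N%:R)%R]] < 1)%E) ->
  forall (F : numFieldType) (modulus : F -> R), scalar_field modulus ->
  forall (d : nat) (Omega : set 'rV[R]_d), compact Omega ->
  forall (p : Omega) (mu : probability (borel (pointed_sub p)) R)
    (N : nat) (X : set (pointed_sub p -> F)),
  (1 <= N)%N ->
  X `<=` @C_space F (pointed_sub p) ->
  subspace_of_dim N X ->
  exists (m : nat) (x : 'I_m -> pointed_sub p),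
    (0 < m)%N /\ m%:R <= c1 * N%:R /\
    forall f, X f ->
      (norm_Phi modulus Phi mu f <= (c2 * K N * norm_2x modulus x f)%:E)%E.
Proof.
(* At most [6 (2 N)] points; and [4 ^ 2 >= 12], where 12 is the constant of
   both the supremum and the integral bound. *)
exists 12, 4; do 2!split=> //.
move=> Phi K PhiP HK F modulus modP d Omega cOmega p mu N X N0 XC Xdim.
have [KN0 supK] := HK N N0.
have [v [v_cont vX]] := real_coordinates modP XC Xdim.
have [C v_bound] : exists C, forall x i, `|v x i 0| <= C.
  have [C hC] :=
    choice (fun i => continuous_set_type_bounded cOmega (v_cont i)).
  exists (\sum_i `|C i|) => x i; rewrite (bigD1 i) //=.
  rewrite (le_trans (hC i x)) // (le_trans (ler_norm _)) // lerDl.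
  by apply: sumr_ge0.
have v_meas i := continuous_borel_measurable (v_cont i).
have NN0 : (0 < N + N)%N by rewrite addn_gt0 N0.
have [s /andP[s0 sN] Hs] := sampling mu NN0 v_meas v_bound.
exists (size s), (tnth (in_tuple s)); split=> //; split.
  by rewrite -natrM ler_nat; apply: leq_trans sN _; lia.
move=> f /vX[a1 [a2 fE]].
have [re [im parts]] := scalar_partsP modP.
have mod0 := modulus_ge0 parts.
set nu := norm_2x modulus _ f.
pose S := \sum_(y <- s) modulus (f y) ^+ 2.
have s0' : 0 < (size s)%:R :> R by rewrite ltr0n.
have SE : S = (size s)%:R * nu ^+ 2.
  rewrite /nu /norm_2x sqr_sqrtr; last first.
    by rewrite mulr_ge0 ?invr_ge0 ?sumr_ge0 // => j _; exact: sqr_ge0.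
  by rewrite mulVKf ?gt_eqF // /S big_tnth.
have nu0 : 0 <= nu by exact: sqrtr_ge0.
have SD : S = \sum_(y <- s) dot a1 (v y) ^+ 2 + \sum_(y <- s) dot a2 (v y) ^+ 2.
  by rewrite -big_split; apply: eq_bigr => y _.
have f_le x : modulus (f x) ^+ 2 <= (12 * N%:R) * nu ^+ 2.
  apply: (@le_trans _ _ S); first by rewrite fE SD lerD // (Hs _).1.
  rewrite SE ler_wpM2r ?sqr_ge0 // -natrM ler_nat.
  by apply: leq_trans sN _; lia.
have mdot a :
    measurable_fun setT (fun x : borel (pointed_sub p) => dot a (v x) ^+ 2).
  apply: measurable_funX; rewrite /dot; under eq_fun do rewrite mxE.
  by apply: measurable_sum => i; apply: measurable_funM.
have fE' : (fun x => modulus (f x) ^+ 2) =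
    fun x => dot a1 (v x) ^+ 2 + dot a2 (v x) ^+ 2.
  exact/funext.
have int_le : (\int[mu]_x (modulus (f x) ^+ 2)%:E <= (12 * nu ^+ 2)%:E)%E.
  under eq_integral do rewrite fE EFinD.
  rewrite ge0_integralD //; first last.
  - exact/measurable_EFinP.
  - by move=> x _; rewrite lee_fin sqr_ge0.
  - exact/measurable_EFinP.
  - by move=> x _; rewrite lee_fin sqr_ge0.
  apply: le_trans (leeD (Hs a1).2 (Hs a2).2) _.
  by rewrite -EFinD -mulrDr -SD SE lee_fin mulrA divfK // gt_eqF.
move: nu0; rewrite le_eqVlt => /orP[/eqP nu0|nu0].
  rewrite -nu0 mulr0; apply: norm_Phi_eq0 => // x; apply/eqP.
  by have := f_le x; rewrite -nu0 expr0n mulr0 exprn_even_le0.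
rewrite mulrAC mulrC.
apply: (@norm_Phi_le _ _ _ mu _ PhiP _ _ _ _ (Num.sqrt N%:R)) => //.
- by rewrite fE'; exact: measurable_funD.
- by rewrite mulr_gt0.
- exact: Phi_le_sqr.
- move=> x; have r0 : 0 <= Num.sqrt N%:R * (4 * nu).
    by rewrite mulr_ge0 ?sqrtr_ge0 // mulr_ge0 // ltW.
  rewrite -(ler_pXn2r (n := 2)) ?nnegrE //.
  rewrite !exprMn sqr_sqrtr ?ler0n //; apply: le_trans (f_le x) _.
  have : 0 <= N%:R * nu ^+ 2 by rewrite mulr_ge0 ?sqr_ge0.
  nra.
apply: le_trans int_le _; rewrite lee_fin; have := sqr_ge0 nu; nra.
Qed.
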